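(* Let $G=(V,E)$ be a finite directed graph with vertices $v_1,\dots,v_N$ in which every vertex has an incoming edge and an outgoing edge, with $|E|\ge2$, and suppose that the edge matrix $A^G=[A^G(e,f)]_{e,f\in E}$ is aperiodic. Let $\varphi$ be a KMS state on the Cuntz-Krieger algebra $\mathcal{O}_{A^G}$ for the gauge action. Let $[t_e]_{e\in E}$ be the positive eigenvector for the Perron-Frobenius eigenvalue $r_G$ of $A^G$ (that is, $\sum_{f\in E}A^G(e,f)t_f=r_Gt_e$) satisfying $\sum_{e\in E}t_e=1$. For each $i=1,\dots,N$ take an edge $e_i\in E$ with $t(e_i)=v_i$. Then for all $n=0,1,2,\dots$ and $i=1,\dots,N$, $$c_n^{G,\varphi}(i)=r_G\,c_n^G(i)\,t_{e_i},\qquad c_n^{G,\varphi}=r_G\sum_{i=1}^N c_n^G(i)\,t_{e_i},$$ and hence $$f_i^{G,\varphi}(x)=r_G\,f_i^G(x)\,t_{e_i},\qquad f^{G,\varphi}(x)=r_G\sum_{i=1}^N f_i^G(x)\,t_{e_i}.$$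
   Context: For $e\in E$, $s(e),t(e)$ are its source and terminal vertex (the function $t(\cdot)$ is not to be confused with the vector $[t_e]$); loops and multiple edges are allowed. $A^G(e,f)=1$ if $t(e)=s(f)$ and $0$ otherwise; aperiodic means some power of $A^G$ has all entries positive. $\mathcal{O}_{A^G}$ is the universal $C^*$-algebra generated by partial isometries $S_e$, $e\in E$, with $\sum_{f\in E}S_fS_f^*=1$ and $S_e^*S_e=\sum_{f\in E}A^G(e,f)S_fS_f^*$. For $v\in V$ put $P_v=\sum_{f\in E,\,s(f)=v}S_fS_f^*$. Gauge action: $\alpha^G_z(S_e)=zS_e$ for $z\in\mathbb{C}$, $|z|=1$; write $\alpha_\tau=\alpha^G_{e^{i\tau}}$ for $\tau\in\mathbb{R}$, extended to complex $\tau$ on analytic elements. A state $\varphi$ is a KMS state at inverse temperature $\beta\in\mathbb{R}$ if $\varphi(ab)=\varphi(b\,\alpha_{i\beta}(a))$ for all $a$ in the dense set of analytic elements and all $b\in\mathcal{O}_{A^G}$ (so $\alpha_{i\beta}(S_e)=e^{-\beta}S_e$). It is a known result (Enomoto-Fujii-Watatani) that for aperiodic $A^G$ such a state exists only for $\beta=\log r_G$, and it is then unique. $G$-Catalan words: let $\Sigma_G=\{S_e^*,S_e\mid e\in E\}$ (a set of $2|E|$ symbols). For a word $X=(X_1,\dots,X_{2n})$ in $\Sigma_G$ put $\pi_G(X)=X_1\cdots X_{2n}\in\mathcal{O}_{A^G}$. Let $\Phi_G$ replace each $S_e$ (resp. $S_e^*$) by the canonical isometry indexed by $e$ (resp. its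 adjoint) in the Cuntz algebra $\mathcal{O}_{|E|}$ generated by isometries $\{\hat S_e\}_{e\in E}$ with $\hat S_e^*\hat S_e=1$, $\sum_e\hat S_e\hat S_e^*=1$. For $n\ge1$, $B_n^G$ is the set of words $X$ of length $2n$ in $\Sigma_G$ with $\pi_G(X)\neq0$ and $\Phi_G(X_1)\cdots\Phi_G(X_{2n})=1$ in $\mathcal{O}_{|E|}$. For each $X\in B_n^G$ there is a unique vertex $v(X)$ with $\pi_G(X)=P_{v(X)}$; put $B_n^G(v_i)=\{X\in B_n^G\mid v(X)=v_i\}$. Set $c_0^G(i)=1$, $c_n^G(i)=|B_n^G(v_i)|$ for $n\ge1$; $c_0^{G,\varphi}=1$, $c_0^{G,\varphi}(i)=\varphi(P_{v_i})$, and for $n\ge1$ $c_n^{G,\varphi}=\sum_{X\in B_n^G}\varphi(\pi_G(X))$, $c_n^{G,\varphi}(i)=\sum_{X\in B_n^G(v_i)}\varphi(\pi_G(X))$. The generating functions are $f_i^G(x)=\sum_nc_n^G(i)x^n$, $f_i^{G,\varphi}(x)=\sum_nc_n^{G,\varphi}(i)x^n$, $f^{G,\varphi}(x)=\sum_nc_n^{G,\varphi}x^n$. *)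

(* Defs.v *)
From HB Require Import structures.
From mathcomp Require Import all_boot all_order all_algebra.
From mathcomp Require Import all_classical all_reals all_analysis.
From mathcomp Require Import complex.

Set Implicit Arguments.
Unset Strict Implicit.
Unset Printing Implicit Defensive.

Import Order.TTheory GRing.Theory Num.Theory.
Import numFieldNormedType.Exports.

Local Open Scope ring_scope.
Local Open Scope complex_scope.

(** * Unital C*-algebras

    MathComp algebras satisfy [1 != 0], so the zero algebra is excluded. This
    does not affect the universal properties below: every algebra has exactly
    one map to the zero algebra. *)

HB.mixin Record isCStarAlgebra (K : numClosedFieldType) (A : Type)
    of CompleteNormedModule K A := {
  cs_one : A ;
  cs_mul : A -> A -> A ;
  star : A -> A ;
  cs_mulA : associative cs_mul ;
  cs_mul1l : left_id cs_one cs_mul ;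
  cs_mul1r : right_id cs_one cs_mul ;
  cs_mulDl : left_distributive cs_mul +%R ;
  cs_mulDr : right_distributive cs_mul +%R ;
  cs_one_neq0 : cs_one != 0 ;
  cs_scaleAl : forall (c : K) (x y : A), c *: cs_mul x y = cs_mul (c *: x) y ;
  cs_scaleAr : forall (c : K) (x y : A), c *: cs_mul x y = cs_mul x (c *: y) ;
  starK : involutive star ;
  starD : forall x y : A, star (x + y) = star x + star y ;
  starZ : forall (c : K) (x : A), star (c *: x) = Num.conj c *: star x ;
  cs_starM : forall x y : A, star (cs_mul x y) = cs_mul (star y) (star x) ;
  cs_normM : forall x y : A, `|cs_mul x y| <= `|x| * `|y| ;
  cs_norm_star : forall x : A, `|cs_mul (star x) x| = `|x| ^+ 2
}.

#[short(type="cstarAlgType")]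
HB.structure Definition CStarAlgebra (K : numClosedFieldType) :=
  {A of CompleteNormedModule K A & isCStarAlgebra K A}.

(* The ring and algebra structures are attached as instances: MathComp cannot
   declare a structure inheriting from both a ring and a normed module. *)
Section CStarAlgebraStructure.
Variables (K : numClosedFieldType) (A : cstarAlgType K).

HB.instance Definition _ := GRing.Zmodule_isNzRing.Build A
  (@cs_mulA K A) (@cs_mul1l K A) (@cs_mul1r K A)
  (@cs_mulDl K A) (@cs_mulDr K A) (@cs_one_neq0 K A).
HB.instance Definition _ :=
  GRing.Lmodule_isLalgebra.Build K A (@cs_scaleAl K A).
HB.instance Definition _ :=
  GRing.Lalgebra_isAlgebra.Build K A (@cs_scaleAr K A).

Lemma starM (x y : A) : star (x * y) = star y * star x.
Proof. exact: cs_starM. Qed.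

Lemma cstar_normM (x y : A) : `|x * y| <= `|x| * `|y|.
Proof. exact: cs_normM. Qed.

Lemma cstar_identity (x : A) : `|star x * x| = `|x| ^+ 2.
Proof. exact: cs_norm_star. Qed.

End CStarAlgebraStructure.

Section CStar.
Variable K : numClosedFieldType.

Definition star_hom (A B : cstarAlgType K) (h : A -> B) : Prop :=
  [/\ linear h, monoid_morphism h & forall x, h (star x) = star (h x)].

Definition is_state (A : cstarAlgType K) (phi : {scalar A}) : Prop :=
  (forall x : A, 0 <= phi (star x * x)) /\ phi 1 = 1.

Definition partial_isometry (A : cstarAlgType K) (x : A) : Prop :=
  x * star x * x = x.

Definition isometry (A : cstarAlgType K) (x : A) : Prop := star x * x = 1.

Definition closed_star_subalgebra (A : cstarAlgType K) (D : set A) : Prop :=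
  [/\ closed D, D 1,
      forall (c : K) x y, D x -> D y -> D (c *: x + y),
      forall x y, D x -> D y -> D (x * y)
    & forall x, D x -> D (star x)].

Definition generates (A : cstarAlgType K) (E : Type) (S : E -> A) : Prop :=
  forall D : set A, closed_star_subalgebra D -> (forall e, D (S e)) ->
  forall x, D x.

Definition universal_cstar (E : Type)
    (rel : forall B : cstarAlgType K, (E -> B) -> Prop)
    (A : cstarAlgType K) (S : E -> A) : Prop :=
  [/\ rel A S, generates S
    & forall (B : cstarAlgType K) (T : E -> B), rel B T ->
        exists h : A -> B, star_hom h /\ forall e, h (S e) = T e].

Definition cuntz_family (E : finType) (B : cstarAlgType K) (T : E -> B) : Prop :=
  (forall e, isometry (T e)) /\ \sum_(e : E) T e * star (T e) = 1.

Definition is_cuntz_algebra (E : finType) (A : cstarAlgType K) (S : E -> A) :=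
  universal_cstar (@cuntz_family E) S.

End CStar.

(** * Finite directed graphs; loops and multiple edges are allowed *)

Record digraph := Digraph {
  vertex : finType ;
  edge : finType ;
  src : edge -> vertex ;
  tgt : edge -> vertex }.

Section Graph.
Variable G : digraph.
Local Notation V := (vertex G).
Local Notation E := (edge G).

Definition adj (e f : E) : nat := tgt e == src f.

Definition edge_mx (F : pzSemiRingType) : 'M[F]_#|E| :=
  \matrix_(i, j) (adj (enum_val i) (enum_val j))%:R.

Definition aperiodic : Prop :=
  exists k : nat, (0 < k)%N /\ forall i j, 0 < (edge_mx int ^+ k) i j.

(* The eigenvalue of maximal modulus among all complex eigenvalues. *)
Definition is_PF_eigenvalue (R : realType) (r : R) : Prop :=
  eigenvalue (edge_mx R) r /\
  forall z : R[i], eigenvalue (edge_mx R[i]) z -> `|z| <= r%:C.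

Section CuntzKrieger.
Variable K : numClosedFieldType.

Definition cuntz_krieger_family (B : cstarAlgType K) (T : E -> B) : Prop :=
  [/\ forall e, partial_isometry (T e),
      \sum_(f : E) T f * star (T f) = 1
    & forall e, star (T e) * T e = \sum_(f : E) (T f * star (T f)) *+ adj e f].

Definition is_cuntz_krieger_algebra (A : cstarAlgType K) (S : E -> A) : Prop :=
  universal_cstar cuntz_krieger_family S.

Definition vertex_proj (A : cstarAlgType K) (S : E -> A) (v : V) : A :=
  \sum_(f : E | src f == v) S f * star (S f).

End CuntzKrieger.

(** * The gauge action and its KMS states *)
Section KMS.
Variable R : realType.
Local Notation C := (R[i]).

Definition is_gauge_action (A : cstarAlgType C) (S : E -> A)
    (alpha : C -> A -> A) : Prop :=
  forall z : C, `|z| = 1 ->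
    star_hom (alpha z) /\ forall e, alpha z (S e) = z *: S e.

Definition expi (tau : R) : C := cos tau +i* sin tau.

(* [F] is the entire extension of [tau |-> alpha_tau a]; it is unique when it
   exists, and [a] is analytic when it exists. *)
Definition analytic_extension (A : cstarAlgType C) (alpha : C -> A -> A)
    (a : A) (F : C^o -> A) : Prop :=
  (forall z : C^o, derivable F z 1) /\
  forall tau : R, F tau%:C = alpha (expi tau) a.

Definition is_KMS_state (A : cstarAlgType C) (alpha : C -> A -> A) (beta : R)
    (phi : {scalar A}) : Prop :=
  is_state phi /\
  forall (a : A) (F : C^o -> A), analytic_extension alpha a F ->
  forall b : A, phi (a * b) = phi (b * F (0 +i* beta)).

End KMS.

(** * Catalan words

    The letter [(e, false)] is the symbol [S_e], the letter [(e, true)] is the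
    symbol [S_e^*]. *)
Section Catalan.
Variables (K : numClosedFieldType) (A OE : cstarAlgType K).
Variables (S : E -> A) (Shat : E -> OE).

Definition letter : finType := (E * bool)%type.

Definition eval_letter (B : cstarAlgType K) (T : E -> B) (x : letter) : B :=
  if x.2 then star (T x.1) else T x.1.

Definition eval_word (B : cstarAlgType K) (T : E -> B) (X : seq letter) : B :=
  \prod_(x <- X) eval_letter T x.

Definition catalan_words (n : nat) : {set (2 * n).-tuple letter} :=
  finset (fun X : (2 * n).-tuple letter =>
    (eval_word S X != 0) && (eval_word Shat X == 1)).

Definition catalan_words_at (n : nat) (v : V) : {set (2 * n).-tuple letter} :=
  finset (fun X : (2 * n).-tuple letter =>
    (X \in catalan_words n) && (eval_word S X == vertex_proj S v)).

Definition catalan_nb (v : V) (n : nat) : nat :=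
  if n is 0 then 1%N else #|catalan_words_at n v|.

Definition catalan_state (phi : A -> K) (n : nat) : K :=
  if n is 0 then 1 else \sum_(X in catalan_words n) phi (eval_word S X).

Definition catalan_state_at (phi : A -> K) (v : V) (n : nat) : K :=
  if n is 0 then phi (vertex_proj S v)
  else \sum_(X in catalan_words_at n v) phi (eval_word S X).

End Catalan.

End Graph.

(** * Generating functions *)
Section GeneratingFunctions.
Variable K : numClosedFieldType.

(* A formal power series is its coefficient sequence, with the pointwise
   [K]-module structure of [nat -> K]. *)
Definition fps : Type := nat -> K.
HB.instance Definition _ := GRing.Lmodule.copy fps (nat -> K^o).
Definition gen_series (c : nat -> K) : fps := c.

Definition gen_terms (c : nat -> K) (x : K) : nat -> K^o :=
  series (fun n => c n * x ^+ n : K^o).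
Definition gen_cvg (c : nat -> K) (x : K) : Prop := cvgn (gen_terms c x).
Definition gen_sum (c : nat -> K) (x : K) : K := limn (gen_terms c x).

End GeneratingFunctions.

(* Main.v *)
(** On a Cuntz-Krieger family the range projections [S_e S_e^*] are pairwise
    orthogonal, so a word reduces by cancelling factors [S_e^* S_f]. A word whose
    image in the Cuntz algebra is [1] cancels completely, and then its image in
    the Cuntz-Krieger algebra is [0] or a vertex projection [P_v]; hence
    [c_n^phi(i) = c_n(i) phi(P_{v_i})]. The KMS condition applied to [S_e] shows
    that the values of [phi] on the projections [S_e S_e^*] form a nonnegative
    eigenvector of the edge matrix, of total mass [1]. As a power of the edge
    matrix is positive, this vector is [t], and the eigenvalue equation for [t]
    gives [phi(P_{v_i}) = r t_{e_i}]. *)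

Require Import Defs.
From mathcomp Require Import all_boot all_order all_algebra.
From mathcomp Require Import all_classical all_reals all_analysis.
From mathcomp Require Import complex.
From mathcomp Require Import ring lra.

Import Order.TTheory GRing.Theory Num.Theory.
Import numFieldNormedType.Exports.

Local Open Scope ring_scope.
Local Open Scope complex_scope.

(** * Orthogonality of range projections in a C*-algebra *)

Section CStarAlgebraLemmas.
Context {R : realType} {A : cstarAlgType R[i]}.
Implicit Types (x y p k : A) (w : R[i]).

Lemma star1 : star (1 : A) = 1.
Proof.
have h : star (star (1 : A) * 1) = star 1 by rewrite starM starK mulr1.
by rewrite -h mulr1 starK.
Qed.

Lemma star0 : star (0 : A) = 0.
Proof. by rewrite -(scale0r (0 : A)) starZ conjC0 !scale0r. Qed.

Lemma starN x : star (- x) = - star x.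
Proof. by rewrite -scaleN1r starZ rmorphN1 scaleN1r. Qed.

Lemma norm_le1_of_idem p : p * p = p -> star p = p -> `|p| <= 1.
Proof.
move=> pp sp; have := cstar_identity p; rewrite sp pp => h.
have [->|p0] := eqVneq p 0; first by rewrite normr0 ler01.
rewrite -(ler_pM2l (x := `|p|)) ?normr_gt0// mulr1 -expr2 -h//.
Qed.

Lemma cstar_norm1 : `|1 : A| <= 1.
Proof. by apply: norm_le1_of_idem; rewrite ?mulr1 ?star1. Qed.

Lemma cstar_eq0 x : star x * x = 0 -> x = 0.
Proof.
move=> h; apply/eqP; rewrite -normr_eq0 -sqrf_eq0 -cstar_identity h normr0//.
Qed.

Lemma norm_sqr_le1 x : `|x| <= 1 -> `|x * x| <= 1.
Proof.
move=> h; apply: le_trans (cstar_normM _ _) _.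
by rewrite mulr_ile1.
Qed.

Lemma norm_avg_le1 x y : `|x| <= 1 -> `|y| <= 1 -> `|2^-1 *: (x + y)| <= 1.
Proof.
move=> hx hy; rewrite normrZ ger0_norm ?invr_ge0 ?ler0n//.
rewrite ler_pdivrMl ?ltr0n// mulr1; apply: le_trans (ler_normD _ _) _.
by rewrite (_ : 2 = 1 + 1) ?lerD.
Qed.

Lemma half_scaler_double x : 2^-1 *: (x + x) = x.
Proof.
rewrite -[x + x]/(x *+ 2) -[x *+ 2]scaler_nat scalerA.
by rewrite mulVf ?scale1r// pnatr_eq0.
Qed.

(** The parameter ranges over the whole disc so that [w] may be replaced by [u * w] with
    [|u| = 1]. *)
Definition disc_contractive p k :=
  forall w : R[i], `|w| <= 1 -> `|p + w *: k| <= 1.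

Lemma corner_mul p k w w' : p * p = p -> p * k = k -> k * p = k ->
  (p + w *: k) * (p + w' *: k) = p + (w + w') *: k + (w * w') *: (k * k).
Proof.
move=> pp pk kp; rewrite mulrDl !mulrDr pp -!scalerAl -!scalerAr pk kp scalerA scalerDl.
by rewrite !addrA (addrAC p).
Qed.

(* If [u^2 = i], the average of [(p + u w k)^2] and [(p + u^-1 w k)^2] has no
   quadratic term and equals [p + s w k] with [s = u + u^-1], where [s^2 = 2]. *)
Lemma disc_contractive_double p k : p * p = p -> p * k = k -> k * p = k ->
  disc_contractive p k -> disc_contractive p (2%:R *: k).
Proof.
move=> pp pk kp.
pose u : R[i] := sqrtC 'i%R; pose s := u + u^-1.
have u2 : u ^+ 2 = 'i%R by rewrite sqrtCK.
have nu : `|u| = 1.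
  apply/eqP; rewrite -(@eqrXn2 _ 2)// ?expr1n ?ler01//.
  by rewrite -normrX u2 normCi.
have u0 : u != 0 by rewrite -normr_gt0 nu ltr01.
have s2 : s * s = 2%:R.
  rewrite /s -expr2 sqrrD mulfV// u2 exprVn u2 invCi.
  by rewrite addrC addKr.
have step k' : p * k' = k' -> k' * p = k' ->
    disc_contractive p k' -> disc_contractive p (s *: k').
  move=> pk' kp' H w hw.
  have H1 v : `|v| = 1 -> `|(p + (v * w) *: k') * (p + (v * w) *: k')| <= 1.
    by move=> hv; apply/norm_sqr_le1/H; rewrite normrM hv mul1r.
  have := norm_avg_le1 _ _ (H1 u nu) (H1 u^-1 _).
  rewrite normfV nu invr1 => /(_ erefl); congr (`|_| <= 1).
  rewrite !corner_mul//.
  have -> : u^-1 * w * (u^-1 * w) = - (u * w * (u * w)).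
    rewrite mulrACA -[in RHS]mulrACA -!expr2 exprVn u2 invCi mulNr//.
  rewrite addrACA scaleNr subrr addr0 addrACA -scalerDl.
  rewrite scalerDr half_scaler_double !scalerA; congr (_ + _ *: _).
  by rewrite /s; field.
(* Two multiplications by [s] produce the factor [s * s = 2]. *)
move=> H; have := step _ _ _ (step _ pk kp H).
rewrite scalerA s2; apply; by rewrite -?scalerAl -?scalerAr ?pk ?kp.
Qed.

(** Repeated doubling keeps both [p + 2^n k] and [p] in the unit ball, so [2^n |k| <= 2] for every
    [n]. *)
Lemma disc_contractive_eq0 p k : p * p = p -> p * k = k -> k * p = k ->
  disc_contractive p k -> k = 0.
Proof.
move=> pp pk kp H.
have Hn n : disc_contractive p ((2 ^+ n) *: k).
  elim: n => [|n IH]; first by rewrite expr0 scale1r.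
  by rewrite exprS -scalerA; apply: disc_contractive_double;
    rewrite -?scalerAl -?scalerAr ?pk ?kp.
have Hb n : 2 ^+ n * `|k| <= 2%:R.
  have h1 := Hn n 1; have h0 := Hn n 0.
  move: h1 h0; rewrite normr1 normr0 lexx ler01 scale1r scale0r addr0.
  move=> /(_ isT) h1 /(_ isT) h0.
  rewrite -[2 ^+ n]ger0_norm ?exprn_ge0 ?ler0n// -normrZ.
  rewrite -(addrK p (2 ^+ n *: k)) (addrC _ p).
  apply: le_trans (ler_normB _ _) _.
  by rewrite (_ : 2 = 1 + 1) ?lerD.
(* Norms lie in [R[i]], so the Archimedean argument passes to the real number [x]; if [x > 0], some
   [n] has [2 / x < n < 2^n], against the bound. *)
pose x := complex.Re `|k|.
have kE : `|k| = x%:C by rewrite RRe_real// ger0_real.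
have [x0|x0] := ltP 0 x; last first.
  by apply/eqP; rewrite -normr_le0 kE -(rmorph0 (real_complex R)) lecR.
exfalso.
pose n := Num.bound (2 / x).
have : 2 < n%:R * x.
  by rewrite -ltr_pdivrMr//; apply: archi_boundP; rewrite divr_ge0// ltW.
apply/negP; rewrite -leNgt -lecR rmorphM/= rmorph_nat.
apply: le_trans (_ : 2 ^+ n * `|k| <= _); last first.
  by rewrite (le_trans (Hb n))// rmorph_nat.
by rewrite kE ler_wpM2r ?ler0c ?(ltW x0)// -natrX ler_nat ltnW// ltn_expl.
Qed.

(* Averaging [(p + k)^2] and [(p - k)^2] bounds [p + k^2 = (p + ik)^* (p + ik)],
   hence [p + ik] and [p - ik]; the convex hull of [1, -1, i, -i] contains the
   disc of radius [1/2]. *)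
Lemma selfadjoint_contractive_eq0 p k : p * p = p -> star p = p ->
  p * k = k -> k * p = k -> star k = k ->
  `|p + k| <= 1 -> `|p - k| <= 1 -> k = 0.
Proof.
move=> pp sp pk kp sk hp hm.
have h2 : `|p + k * k| <= 1.
  have := norm_avg_le1 _ _ (norm_sqr_le1 _ hp) (norm_sqr_le1 _ hm).
  congr (`|_| <= 1); rewrite -scaleN1r -[X in p + X]scale1r !corner_mul//.
  rewrite mulrNN -opprD scaleNr addrACA [X in X + _]addrACA subrr addr0.
  rewrite !mul1r !scale1r.
  by rewrite scalerDr !half_scaler_double.
have hI (c : R[i]) : c * Num.conj c = 1 -> Num.conj c = - c -> `|p + c *: k| <= 1.
  move=> cc cN; rewrite -(@expr_le1 _ 2)// -cstar_identity.
  rewrite starD starZ sp sk corner_mul// cN addNr scale0r addr0.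
  by rewrite -cN mulrC cc scale1r.
have hreal (x : R) : `|x| <= 1 -> forall c : A, `|p + c| <= 1 -> `|p - c| <= 1 ->
    `|p + x%:C *: c| <= 1.
  move=> hx c h1 h3.
  have -> : p + x%:C *: c = ((1 + x) / 2)%:C *: (p + c) + ((1 - x) / 2)%:C *: (p - c).
    rewrite !scalerDr scalerN addrACA -scalerBl -scalerDl.
    rewrite -rmorphD -rmorphB.
    have -> : (1 + x) / 2 + (1 - x) / 2 = 1 by field.
    have -> : (1 + x) / 2 - (1 - x) / 2 = x by field.
    by rewrite rmorph1 scale1r.
  move: hx; rewrite ler_norml => /andP[x1 x2].
  have y1 : 0 <= (1 + x) / 2 by lra.
  have y2 : 0 <= (1 - x) / 2 by lra.
  rewrite (le_trans (ler_normD _ _))// !normrZ !ger0_norm ?ler0c//.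
  apply: le_trans (_ : ((1 + x) / 2)%:C * 1 + ((1 - x) / 2)%:C * 1 <= _).
    by rewrite lerD// ler_wpM2l// ler0c.
  by rewrite !mulr1 -rmorphD (_ : (1 + x) / 2 + (1 - x) / 2 = 1)//; field.
have : disc_contractive p (2^-1 *: k).
  move=> w hw; pose a := complex.Re w; pose b := complex.Im w.
  have wE : w = a%:C + 'i%C * b%:C by rewrite [LHS]complexE.
  have ha : `|a| <= 1.
    by rewrite -lecR (le_trans (normc_ge_Re w)).
  have hb : `|b| <= 1.
    rewrite -lecR -normrN -ReiNIm (le_trans (normc_ge_Re _))// normrM.
    by rewrite complexiE normCi mulr1.
  have h1 := hreal a ha k hp hm.
  have h3 : `|p + b%:C *: ('i%C *: k)| <= 1.
    by apply: hreal => //; rewrite -?scaleNr; apply: hI;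
      rewrite complexiE ?rmorphN/= ?conjCi ?mulrNN ?mulrN -?expr2 ?sqrCi ?opprK.
  have := norm_avg_le1 _ _ h1 h3; congr (`|_| <= 1).
  rewrite addrACA scalerA -scalerDl wE scalerDr half_scaler_double.
  by rewrite !scalerA [2^-1 * _]mulrC [b%:C * _]mulrC.
move=> /disc_contractive_eq0.
rewrite -scalerAl -scalerAr pk kp => /(_ pp erefl erefl)/eqP.
by rewrite scaler_eq0 invr_eq0 pnatr_eq0 => /eqP.
Qed.
End CStarAlgebraLemmas.

(** * Range projections that sum to the unit *)

Section RangeProjections.
Context {R : realType} {E : finType} {A : cstarAlgType R[i]} {T : E -> A}.
Hypothesis T_pi : forall e, partial_isometry (T e).
Hypothesis T_sum : \sum_(e : E) T e * star (T e) = 1.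

Let P e : A := T e * star (T e).

Lemma range_proj_idem e : P e * P e = P e.
Proof. by rewrite /P mulrA T_pi. Qed.

Lemma star_range_proj e : star (P e) = P e.
Proof. by rewrite /P starM starK. Qed.

(** The element [1 - 2p] is self-adjoint with square [1], so the C*-identity bounds its norm by
    [1]. *)
Lemma norm_half_sub_idem (p : A) : p * p = p -> star p = p ->
  `|2^-1 *: 1 - p| <= 2^-1.
Proof.
move=> pp sp.
have -> : 2^-1 *: 1 - p = 2^-1 *: (1 - (p + p)) by rewrite scalerBr half_scaler_double.
rewrite normrZ ger0_norm ?invr_ge0 ?ler0n// ler_piMr ?invr_ge0 ?ler0n//.
rewrite -(@expr_le1 _ 2)// -cstar_identity starD starN starD star1 sp.
rewrite mulrBl mul1r mulrBr mulr1 mulrDl mulrDr !pp opprB.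
rewrite addrK subrK; exact: cstar_norm1.
Qed.

(* [M P_e + P_e P_f P_e] is the compression by [P_e] of
   [M - sum_(g <> e, f) P_g] while [M P_e - P_e P_f P_e] is that of [M - P_f];
   both have norm at most [M] when [M] is large, so [P_e P_f P_e = 0]. *)
Lemma range_proj_orth e f : f != e -> P f * P e = 0.
Proof.
move=> fe; apply: cstar_eq0; rewrite starM !star_range_proj.
rewrite -mulrA [P f * _]mulrA range_proj_idem.
set b := P e * (P f * P e).
(* This [M] bounds a sum of [#|E|] terms, each [1/2] or [1/2 - P g] and hence of norm at most
   [1/2]. *)
pose M : R[i] := #|E|%:R / 2.
have E0 : (0 < #|E|)%N by apply/card_gt0P; exists e.
have M0 : 0 < M by rewrite divr_gt0 ?ltr0n.
have Mh : 2^-1 <= M by rewrite -[2^-1]mul1r ler_wpM2r ?invr_ge0// ler1n.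
have cmpr (x : A) : `|P e * x * P e| <= `|x|.
  have P1 : `|P e| <= 1 by apply: norm_le1_of_idem; rewrite ?range_proj_idem ?star_range_proj.
  apply: le_trans (cstar_normM _ _) _.
  apply: le_trans (_ : `|P e * x| * 1 <= _); first by rewrite ler_wpM2l.
  rewrite mulr1; apply: le_trans (cstar_normM _ _) _.
  by rewrite ler_piMl.
have scl (c x : A) : `|M *: c + x| <= M -> `|c + M^-1 *: x| <= 1.
  move=> h; have -> : c + M^-1 *: x = M^-1 *: (M *: c + x).
    by rewrite scalerDr scalerA mulVf ?gt_eqF// scale1r.
  by rewrite normrZ ger0_norm ?invr_ge0 ?(ltW M0)// ler_pdivrMl// mulr1.
have M1 (e' : A) : P e * (M *: e' ) * P e = M *: (P e * e' * P e).
  by rewrite -scalerAr -scalerAl.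
have bp : M^-1 *: b = 0.
  apply: (@selfadjoint_contractive_eq0 _ _ (P e)).
  - exact: range_proj_idem.
  - exact: star_range_proj.
  - by rewrite -scalerAr /b (mulrA (P e) (P e)) range_proj_idem.
  - by rewrite -scalerAl /b -(mulrA (P e)) -(mulrA (P f)) range_proj_idem.
  - rewrite starZ conj_Creal ?rpredV ?realE ?(ltW M0)//.
    by rewrite /b (starM (P e)) (starM (P f)) !star_range_proj -(mulrA (P e)).
  - apply: scl.
    (* The subtracted projections add up to [1 - (P e + P f)], whose compression by [P e] is
       [- b]. *)
    have -> : M *: P e + b =
        P e * (\sum_(g : E) (2^-1 *: 1 - (P g *+ ((g != e) && (g != f))))) * P e.
      rewrite sumrB sumr_const scalerMnl -[_ *+ #|E|]mulr_natl -/M.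
      rewrite mulrBr mulrBl M1 mulr1 range_proj_idem; congr (_ + _).
      have S1 : \sum_(g | (g != e) && (g != f)) P g = 1 - (P e + P f).
        by rewrite -T_sum [in RHS](bigD1 e)//= [in RHS](bigD1 f)//= addrA [X in X - _]addrC addrK.
      have -> : \sum_(g : E) P g *+ ((g != e) && (g != f)) = 1 - (P e + P f).
        by rewrite -S1 [RHS]big_mkcond; apply: eq_bigr => g _; case: ifP.
      rewrite mulrBr mulr1 mulrDr range_proj_idem opprD addrA subrr add0r.
      by rewrite mulNr opprK /b -(mulrA (P e)).
    apply: le_trans (cmpr _) _; apply: le_trans (ler_norm_sum _ _ _) _.
    apply: le_trans (_ : \sum_(g : E) 2^-1 <= _).
      apply: ler_sum => g _; case: (_ && _); first last.
        rewrite subr0 normrZ ger0_norm ?invr_ge0// ler_piMr ?invr_ge0//.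
        exact: cstar_norm1.
      by apply: norm_half_sub_idem; [exact: range_proj_idem|exact: star_range_proj].
    by rewrite sumr_const -[X in X <= _]mulr_natl.
  - rewrite -scalerN; apply: scl.
    (* The two summands have norms at most [M - 1/2] and [1/2]. *)
    have -> : M *: P e - b = P e * ((M - 2^-1) *: 1 + (2^-1 *: 1 - P f)) * P e.
      rewrite addrA -scalerDl subrK mulrBr mulrBl M1 mulr1 range_proj_idem.
      by rewrite /b -(mulrA (P e)).
    apply: le_trans (cmpr _) _; apply: le_trans (ler_normD _ _) _.
    rewrite -[X in _ <= X](subrK 2^-1) lerD//; last first.
      by apply: norm_half_sub_idem; [exact: range_proj_idem|exact: star_range_proj].
    by rewrite normrZ ger0_norm ?subr_ge0// ler_piMr ?subr_ge0//; exact: cstar_norm1.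
by move/eqP: bp; rewrite scaler_eq0 invr_eq0 gt_eqF// => /eqP.
Qed.

(** Since [T f] and [T e] absorb their range projections on the left, the product contains
    [P f * P e = 0]. *)
Lemma partial_isometry_orth e f : f != e -> star (T f) * T e = 0.
Proof.
move=> fe.
have sT : star (T f) = star (T f) * P f by rewrite -star_range_proj -starM /P T_pi.
have eT : T e = P e * T e by rewrite /P T_pi.
by rewrite sT eT mulrA -(mulrA (star _)) range_proj_orth// mulr0 mul0r.
Qed.
End RangeProjections.

(** * Reduction of words *)

Section Reduction.
Context {G : digraph}.
Local Notation E := (edge G).

(* [Some (mu, nu)] stands for the word [S_mu S_nu^*], where [S_nu^*] is written
   as the product of the [S_e^*] in the order of the list [nu], and [None] for
   a word that vanishes in every Cuntz family. *)
Definition push_letter (x : letter G) (s : option (seq E * seq E)) :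
    option (seq E * seq E) :=
  if s is Some (mu, nu) then
    if x.2 then
      if mu is f :: mu' then if x.1 == f then Some (mu', nu) else None
      else Some ([::], x.1 :: nu)
    else Some (x.1 :: mu, nu)
  else None.

Definition reduce_word (X : seq (letter G)) : option (seq E * seq E) :=
  foldr push_letter (Some ([::], [::])) X.

Section Eval.
Context {R : realType} {A : cstarAlgType R[i]} (T : E -> A).

Definition eval_path (mu : seq E) : A := \prod_(e <- mu) T e.
Definition eval_copath (nu : seq E) : A := \prod_(e <- nu) star (T e).

Lemma eval_path_nil : eval_path [::] = 1. Proof. exact: big_nil. Qed.
Lemma eval_path_cons e mu : eval_path (e :: mu) = T e * eval_path mu.
Proof. exact: big_cons. Qed.
Lemma eval_copath_nil : eval_copath [::] = 1. Proof. exact: big_nil. Qed.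
Lemma eval_copath_cons e nu : eval_copath (e :: nu) = star (T e) * eval_copath nu.
Proof. exact: big_cons. Qed.

Lemma eval_word_nil : eval_word T [::] = 1. Proof. exact: big_nil. Qed.
Lemma eval_word_cons x X : eval_word T (x :: X) = eval_letter T x * eval_word T X.
Proof. exact: big_cons. Qed.

(** Here [star (T e) * T f] is [1] or [0], so [push_letter] computes left multiplication by a letter
    exactly. *)
Lemma eval_word_cuntz X : cuntz_family T ->
  eval_word T X =
    if reduce_word X is Some (mu, nu) then eval_path mu * eval_copath nu else 0.
Proof.
move=> [T_iso T_sum].
have T_pi e : partial_isometry (T e) by rewrite /partial_isometry -mulrA T_iso mulr1.
elim: X => [|[e b] X IH].
  by rewrite eval_word_nil /= eval_path_nil eval_copath_nil mulr1.
rewrite eval_word_cons {}IH /=.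
case: (reduce_word X) => [[mu nu]|]; last by rewrite mulr0.
rewrite /eval_letter /=; case: b => /=; last by rewrite eval_path_cons mulrA.
case: mu => [|f mu].
  by rewrite eval_path_nil eval_copath_cons !mul1r.
rewrite eval_path_cons; case: eqVneq => [->|ef].
  by rewrite !mulrA T_iso mul1r.
by rewrite !mulrA (partial_isometry_orth T_pi T_sum) ?mul0r.
Qed.

Lemma cuntz_isometry_neq0 e : cuntz_family T -> T e != 0.
Proof.
move=> [T_iso _]; apply/eqP => h; have := T_iso e; rewrite /Defs.isometry h mulr0.
by move/eqP; rewrite eq_sym oner_eq0.
Qed.

(** If a nonempty reduced word were [1], choose [g] different from the first letter of [mu], or from
    the last letter of [nu] when [mu] is empty. Multiplying by [star (T g)] on the left,
    respectively by [T g] on the right, would give [T g = 0]. A second edge is what makes [g]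
    available. *)
Lemma reduce_word_of_cuntz_eq1 X : (1 < #|E|)%N -> cuntz_family T ->
  eval_word T X = 1 -> reduce_word X = Some ([::], [::]).
Proof.
move=> E2 T_cuntz; have [T_iso T_sum] := T_cuntz.
have T_pi e : partial_isometry (T e) by rewrite /partial_isometry -mulrA T_iso mulr1.
have other e : exists g : E, g != e.
  have : (0 < #|predC1 e|)%N by rewrite cardC1 -subn1 subn_gt0.
  by case/card_gt0P => g ge; exists g.
rewrite (eval_word_cuntz _ T_cuntz).
case: (reduce_word X) => [[[|e mu] nu]|].
- case/lastP: nu => [//|nu e].
  rewrite eval_path_nil mul1r /eval_copath -cats1 big_cat big_seq1 /= => h.
  have [g ge] := other e.
  have /eqP[] := cuntz_isometry_neq0 g T_cuntz.
  rewrite -[T g]mul1r -h -mulrA (partial_isometry_orth T_pi T_sum) ?mulr0 //.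
  by rewrite eq_sym.
- rewrite eval_path_cons => h; have [g ge] := other e.
  have /eqP[] := cuntz_isometry_neq0 g T_cuntz.
  rewrite -[T g]starK -[star (T g)]mulr1 -h !mulrA.
  by rewrite (partial_isometry_orth T_pi T_sum) ?mul0r ?star0.
- by move/eqP; rewrite eq_sym oner_eq0.
Qed.

(** * Words in a Cuntz-Krieger family *)

Section CuntzKriegerFamily.
Hypothesis T_ck : cuntz_krieger_family T.

Let T_pi e : partial_isometry (T e). Proof. by case: T_ck. Qed.
Let T_sum : \sum_(f : E) T f * star (T f) = 1. Proof. by case: T_ck. Qed.

Lemma star_mul_self e : star (T e) * T e = vertex_proj T (tgt e).
Proof.
have [_ _ ->] := T_ck; rewrite /vertex_proj [RHS]big_mkcond.
by apply: eq_bigr => f _; rewrite /adj eq_sym; case: eqP.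
Qed.

Lemma vertex_proj_mul_edge v e :
  vertex_proj T v * T e = if src e == v then T e else 0.
Proof.
rewrite /vertex_proj mulr_suml; case: ifP => [ev|ev].
  rewrite (bigD1 e)//= T_pi big1 ?addr0// => f /andP[_ fe].
  by rewrite -mulrA (partial_isometry_orth T_pi T_sum) ?mulr0.
rewrite big1 // => f /eqP fv; rewrite -mulrA (partial_isometry_orth T_pi T_sum) ?mulr0//.
by apply/eqP => fe; rewrite -fv fe eqxx in ev.
Qed.

Lemma star_vertex_proj v : star (vertex_proj T v) = vertex_proj T v.
Proof.
rewrite /vertex_proj (big_morph _ (@starD _ A) (@star0 R A)).
by apply: eq_bigr => f _; rewrite starM starK.
Qed.

Lemma star_edge_mul_vertex_proj v e :
  star (T e) * vertex_proj T v = if src e == v then star (T e) else 0.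
Proof.
rewrite -star_vertex_proj -starM vertex_proj_mul_edge.
by case: ifP => // _; rewrite star0.
Qed.

Lemma vertex_proj_mul v w :
  vertex_proj T v * vertex_proj T w = if v == w then vertex_proj T v else 0.
Proof.
rewrite {2}/vertex_proj mulr_sumr; case: eqVneq => [->|vw].
  by apply: eq_bigr => f fw; rewrite mulrA vertex_proj_mul_edge fw.
by apply: big1 => f /eqP fw; rewrite mulrA vertex_proj_mul_edge fw eq_sym (negPf vw) mul0r.
Qed.

Lemma sum_vertex_proj : \sum_v vertex_proj T v = 1.
Proof. by rewrite -T_sum [RHS](partition_big (@src G) predT). Qed.

(** Unlike in a Cuntz family, cancelling [star (T e) * T e] leaves a vertex projection. A
    neighbouring edge absorbs it or annihilates the word, so at most one projection remains, between
    [mu] and [nu]. The implication in the second alternative records that a nonempty word that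
    cancels completely cannot lose its projection. *)
Lemma eval_word_cuntz_krieger X mu nu : reduce_word X = Some (mu, nu) ->
  [\/ eval_word T X = 0,
      eval_word T X = eval_path mu * eval_copath nu /\
        (mu = [::] -> nu = [::] -> X = [::])
    | exists v, eval_word T X = eval_path mu * vertex_proj T v * eval_copath nu].
Proof.
elim: X mu nu => [|[e b] X IH] mu nu.
  case=> <- <-; rewrite eval_word_nil eval_path_nil eval_copath_nil mulr1.
  by apply: Or32.
rewrite eval_word_cons /=; move: IH.
case: (reduce_word X) => [[mu' nu']|//] /(_ _ _ erefl) IH.
rewrite /eval_letter /=; case: b => /=; last first.
  case=> <- <-; case: IH => [->|[-> _]|[v ->]].
  - by apply: Or31; rewrite mulr0.
  - by apply: Or32; rewrite eval_path_cons mulrA.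
  - by apply: Or33; exists v; rewrite eval_path_cons !mulrA.
case: IH => [->|[-> _]|[v ->]].
- by move=> _; apply: Or31; rewrite mulr0.
- case: mu' => [|f mu'].
    case=> <- <-; apply: Or32.
    by rewrite eval_path_nil eval_copath_cons !mul1r.
  case: eqVneq => // <-{f} [<- <-].
  rewrite eval_path_cons !mulrA star_mul_self.
  case: mu' => [|g mu'].
    by apply: Or33; exists (tgt e); rewrite eval_path_nil mul1r mulr1.
  rewrite eval_path_cons mulrA vertex_proj_mul_edge; case: ifP => _.
    by apply: Or32.
  by apply: Or31; rewrite !mul0r.
- case: mu' => [|f mu'].
    (* With no edge left to cancel, [star (T e)] meets [P_v] and absorbs it or gives [0]. *)
    case=> <- <-; rewrite eval_path_nil mul1r mulrA star_edge_mul_vertex_proj.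
    case: ifP => _; last by apply: Or31; rewrite mul0r.
    by apply: Or32; rewrite mul1r eval_copath_cons.
  case: eqVneq => // <-{f} [<- <-].
  rewrite eval_path_cons !mulrA star_mul_self.
  (* If the path is used up, the new projection meets the old one: they are equal or orthogonal. *)
  case: mu' => [|g mu'].
    rewrite eval_path_nil mulr1 vertex_proj_mul; case: ifP => _.
      by apply: Or33; exists (tgt e); rewrite mul1r.
    by apply: Or31; rewrite mul0r.
  rewrite eval_path_cons mulrA vertex_proj_mul_edge; case: ifP => _.
    by apply: Or33; exists v.
  by apply: Or31; rewrite !mul0r.
Qed.

End CuntzKriegerFamily.
End Eval.

Lemma catalan_word_vertex_proj {R : realType} {A B : cstarAlgType R[i]}
    (S : E -> A) (Shat : E -> B) n (X : (2 * n.+1).-tuple (letter G)) :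
  (1 < #|E|)%N -> cuntz_krieger_family S -> cuntz_family Shat ->
  X \in catalan_words S Shat n.+1 -> exists v, eval_word S X = vertex_proj S v.
Proof.
move=> E2 S_ck S_c; rewrite inE => /andP[/eqP X0 /eqP /(reduce_word_of_cuntz_eq1 _ _ E2 S_c)].
(* A nonzero value excludes the first alternative, positive length the second. *)
move=> /(eval_word_cuntz_krieger _ S_ck)[//|[_ /(_ erefl erefl) Xnil]|[v ->]].
  by have := size_tuple X; rewrite Xnil.
by exists v; rewrite eval_path_nil eval_copath_nil mul1r mulr1.
Qed.
End Reduction.

(** * Positive matrices *)

Section PositiveMatrix.
Context {R : realType} {n : nat} (B : 'M[R]_n).
Hypothesis B_gt0 : forall i j, 0 < B i j.

Lemma pos_mx_mul_gt0 (z : 'cV[R]_n) i :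
  (forall j, 0 <= z j 0) -> z != 0 -> 0 < (B *m z) i 0.
Proof.
move=> z0 /eqP zN; rewrite lt_def mxE sumr_ge0 ?andbT => [|j _]; last first.
  by rewrite mulr_ge0 ?(ltW (B_gt0 _ _)).
apply/eqP => /eqP; rewrite psumr_eq0 => [/allP s0|j _]; last by rewrite mulr_ge0 ?(ltW (B_gt0 _ _)).
apply: zN; apply/colP => j; rewrite mxE.
have := s0 j (mem_index_enum _); rewrite mulf_eq0 gt_eqF//= => /eqP//.
Qed.

(* Comparing [x] with [c y] for the least and the largest ratio [c = x_i / y_i]
   bounds [a - b] from both sides unless [x] is a multiple of [y]. *)
Lemma pos_mx_eigenvector_unique (x y : 'cV[R]_n) (a b : R) :
  (forall i, 0 <= x i 0) -> (forall i, 0 < y i 0) ->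
  B *m x = a *: x -> B *m y = b *: y ->
  \sum_i x i 0 = 1 -> \sum_i y i 0 = 1 -> x = y.
Proof.
move=> x0 y0 Bx By sx sy.
have prop c : x = c *: y -> x = y.
  move=> xc; have : \sum_i x i 0 = c * \sum_i y i 0.
    by rewrite mulr_sumr; apply: eq_bigr => i _; rewrite xc mxE.
  by rewrite sx sy mulr1 => c1; rewrite xc -c1 scale1r.
have [i0 _|n0] := pickP (@predT 'I_n); last first.
  by have /eqP[] := oner_neq0 R; rewrite -sx big_pred0.
pose q i := x i 0 / y i 0.
have qy i : q i * y i 0 = x i 0 by rewrite divfK ?gt_eqF.
have q0 i : 0 <= q i by rewrite divr_ge0 ?(ltW (y0 _)).
have [i _ minq] := @arg_minP _ _ _ i0 predT q erefl.
have [j _ maxq] := @arg_maxP _ _ _ i0 predT q erefl.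
have [/eqP|zN] := eqVneq (x - q i *: y) 0.
  by rewrite subr_eq0 => /eqP /prop.
have [/eqP|wN] := eqVneq (q j *: y - x) 0.
  by rewrite subr_eq0 => /eqP /esym /prop.
have z0 k : 0 <= (x - q i *: y) k 0.
  by rewrite !mxE subr_ge0 -[leRHS]qy ler_wpM2r ?(ltW (y0 _))// minq.
have w0 k : 0 <= (q j *: y - x) k 0.
  by rewrite !mxE subr_ge0 -[leLHS]qy ler_wpM2r ?(ltW (y0 _))//; exact: maxq.
(* At row [i] one has [x_i = q_i y_i], so positivity reads [(a - b) x_i > 0]; at row [j] it reads
   [(b - a) x_j > 0]. As [x] is nonnegative, these are incompatible. *)
have := pos_mx_mul_gt0 _ i z0 zN; have := pos_mx_mul_gt0 _ j w0 wN.
rewrite !mulmxBr -!scalemxAr Bx By !mxE -!qy => hj hi.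
have [ab|ba] := leP a b.
  have : 0 < (a - b) * (q i * y i 0) by move: hi; congr (0 < _); ring.
  by rewrite ltNge mulr_le0_ge0 ?subr_le0// mulr_ge0 ?(ltW (y0 _)).
have : 0 < (b - a) * (q j * y j 0) by move: hj; congr (0 < _); ring.
by rewrite ltNge mulr_le0_ge0 ?subr_le0 ?(ltW ba)// mulr_ge0 ?(ltW (y0 _)).
Qed.
End PositiveMatrix.

(** * The entire function [z |-> e^(iz)] *)

Section ComplexExponential.
Context {R : realType}.
Local Open Scope classical_set_scope.

(** Multiplying the difference quotient by [h] makes the estimate valid at [h = 0] too and lets
    remainders be added. *)
Lemma derive_remainder (f : R -> R) (c df : R) : is_derive c 1 f df ->
  forall eps, 0 < eps -> \forall h \near 0, `|f (h + c) - f c - df * h| <= eps * `|h|.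
Proof.
move=> [f_ex f_val] eps eps0.
have cvf : h^-1 *: ((f \o shift c) (h *: 1) - f c) @[h --> 0^'] --> df.
  by rewrite -f_val; exact: f_ex.
have /cvgrPdist_le/(_ eps eps0) := cvf.
rewrite near_withinE; apply: filterS => h hh.
have [->|h0] := eqVneq h 0.
  by rewrite add0r subrr mulr0 subrr normr0 mulr0.
have {hh} := hh h0; rewrite /= -[in X in X -> _](ler_pM2r (x := `|h|)) ?normr_gt0//.
rewrite -normrM distrC; congr (`|_| <= _).
by rewrite /GRing.scale/= mulr1; field.
Qed.

Definition cexpi (z : R[i]) : R[i] :=
  (expR (- complex.Im z))%:C * (cos (complex.Re z) +i* sin (complex.Re z)).

Lemma cexpi_real (tau : R) : cexpi tau%:C = expi tau.
Proof. by rewrite /cexpi /= oppr0 expR0 mul1r. Qed.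

Lemma cexpi_imag (beta : R) : cexpi (0 +i* beta) = (expR (- beta))%:C.
Proof. by rewrite /cexpi /= cos0 sin0 mulr1. Qed.

Lemma cexpiD z w : cexpi (z + w) = cexpi z * cexpi w.
Proof.
case: z w => [a b] [c d]; rewrite /cexpi /= cosD sinD opprD expRD rmorphM/=.
rewrite mulrACA; congr (_ * _); apply/eqP; rewrite eq_complex /=; apply/andP.
by split; apply/eqP; ring.
Qed.

Lemma norm_Im_le (z : R[i]) : (`|complex.Im z|)%:C <= `|z|.
Proof.
rewrite -normrN -ReiNIm (le_trans (normc_ge_Re _))// normrM.
by rewrite complexiE normCi mulr1.
Qed.

Lemma norm_real_complex (a : R) : `|a%:C| = `|a|%:C :> R[i].
Proof. by rewrite normc_def /= expr0n addr0 sqrtr_sqr. Qed.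

Lemma norm_complex_le (z : R[i]) : `|z| <= (`|complex.Re z| + `|complex.Im z|)%:C.
Proof.
rewrite {1}[z]complexE (le_trans (ler_normD _ _))// normrM complexiE normCi mul1r.
by rewrite rmorphD/= !norm_real_complex.
Qed.

(** Both [|Re z|] and [|Im z|] are at most [|z|], so real estimates near [0] transfer to complex
    arguments. *)
Lemma nbhs0_real_complex (P : R -> Prop) :
  (\forall x \near 0, P x) ->
  \forall z \near (0 : R[i]^o), P (complex.Re z) /\ P (complex.Im z).
Proof.
move=> /nbhs_norm0P[d /= d0 dP].
apply/nbhs_norm0P; exists d%:C; first by rewrite /= ltcR.
move=> z /= zd; split; apply: dP => /=; rewrite -ltcR.
  exact: le_lt_trans (normc_ge_Re _) zd.
exact: le_lt_trans (norm_Im_le _) zd.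
Qed.

Lemma cexpi_derive0 :
  (fun h : R[i]^o => h^-1 * (cexpi h - 1) : R[i]^o) @ (0 : R[i]^o)^' -->
    ('i%C : R[i]^o).
Proof.
apply/(@cvgrPdist_le _ R[i]^o) => eps eps0.
(* The real part of the remainder costs [e |y| + 2 e |x|] and the imaginary part [3 e |x|], in total
   at most [6 e |h|]. *)
pose e := complex.Re eps / 6.
have epsE : eps = (complex.Re eps)%:C by rewrite RRe_real// gtr0_real.
have e0 : 0 < e by rewrite divr_gt0//; move: eps0; rewrite {1}epsE ltcR.
have exp_near : \forall x \near (0 : R), `|expR (- x) - 1 + x| <= e * `|x|.
  have : is_derive (0 : R) 1 (fun x => expR (- x)) (- 1).
    by apply: is_derive_eq; rewrite oppr0 expR0 mul1r.
  move=> /derive_remainder /(_ e e0); apply: filterS => x.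
  by rewrite addr0 oppr0 expR0 mulN1r opprK.
have cos_near : \forall x \near (0 : R), `|cos x - 1| <= e * `|x|.
  have := derive_remainder _ _ _ (is_derive_cos (0 : R)) e e0.
  by apply: filterS => x; rewrite addr0 cos0 sin0 oppr0 mul0r subr0.
have sin_near : \forall x \near (0 : R), `|sin x - x| <= e * `|x|.
  have := derive_remainder _ _ _ (is_derive_sin (0 : R)) e e0.
  by apply: filterS => x; rewrite addr0 sin0 cos0 subr0 mul1r.
(* The bound [1] gives [expR (- y) <= 2]; the bound [e] controls the cross term
   [(expR (- y) - 1) * x]. *)
have exp2 : \forall x \near (0 : R), `|expR (- x) - 1| <= Num.min e 1.
  have cv : expR (- x) @[x --> (0 : R)] --> (1 : R).
    have : {for (0 : R), continuous (expR \o -%R : R -> R)}.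
      by apply: continuous_comp; [exact: opp_continuous|exact: continuous_expR].
    by rewrite /prop_for /continuous_at /= oppr0 expR0.
  have m0 : 0 < Num.min e 1 by rewrite lt_min e0 ltr01.
  have /cvgrPdist_le/(_ _ m0) := cv; apply: filterS => x.
  by rewrite distrC.
have all_near : \forall x \near (0 : R),
    [/\ `|expR (- x) - 1 + x| <= e * `|x|, `|cos x - 1| <= e * `|x|,
       `|sin x - x| <= e * `|x| & `|expR (- x) - 1| <= Num.min e 1].
  by near=> x; split; near: x.
rewrite near_withinE; apply: filterS (nbhs0_real_complex _ all_near) => h.
pose x := complex.Re h; pose y := complex.Im h.
move=> [[_ x1 x2 _] [y3 _ _ y12]] h0.
have hx : (`|x|)%:C <= `|h| := normc_ge_Re h.
have hy : (`|y|)%:C <= `|h| := norm_Im_le h.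
have : `|'i%C * h - (cexpi h - 1)| <= eps * `|h|.
  rewrite distrC.
  move: y12; rewrite !le_min => /andP[y1 y2].
  have E2 : `|expR (- y)| <= 2.
    by rewrite -[expR _](subrK 1) (le_trans (ler_normD _ _))// normr1 -[2]/(1 + 1) lerD.
  have hRe : `|complex.Re (cexpi h - 1 - 'i%C * h)| <= e * `|y| + 2 * (e * `|x|).
    have -> : complex.Re (cexpi h - 1 - 'i%C * h) =
        (expR (- y) - 1 + y) + expR (- y) * (cos x - 1).
      by rewrite /cexpi /x /y; case: (h) => u v /=; ring.
    by rewrite (le_trans (ler_normD _ _))// lerD// normrM ler_pM.
  have hIm : `|complex.Im (cexpi h - 1 - 'i%C * h)| <= 2 * (e * `|x|) + e * `|x|.
    have -> : complex.Im (cexpi h - 1 - 'i%C * h) =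
        expR (- y) * (sin x - x) + (expR (- y) - 1) * x.
      by rewrite /cexpi /x /y; case: (h) => u v /=; ring.
    by rewrite (le_trans (ler_normD _ _))// lerD// normrM ler_pM.
  apply: le_trans (norm_complex_le _) _.
  apply: (@le_trans _ _ ((5 * e)%:C * (`|x|)%:C + e%:C * (`|y|)%:C)).
    by rewrite -!rmorphM -rmorphD lecR; lra.
  apply: (@le_trans _ _ ((5 * e)%:C * `|h| + e%:C * `|h|)).
    have e5 : 0 <= 5 * e by rewrite mulr_ge0// ltW.
    by rewrite lerD// ler_wpM2l// ler0c ?e5 ?(ltW e0).
  rewrite -mulrDl -rmorphD epsE (_ : 5 * e + e = complex.Re eps)//.
  by rewrite /e; field.
have hn : 0 < `|h : R[i]| by rewrite normr_gt0.
move=> H; suff : `|'i%C - h^-1 * (cexpi h - 1)| * `|h| <= eps * `|h| by rewrite ler_pM2r.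
rewrite -normrM [leLHS](_ : _ = `|'i%C * h - (cexpi h - 1)|)//.
by congr (`|_|); field.
Unshelve. all: by end_near.
Qed.

(** The functional equation [cexpiD] carries the derivative at [0] to every [z]. With [v = S e] this
    function extends the gauge orbit of a generator. *)
Lemma cexpi_scale_derivable (V : normedModType R[i]) (v : V) (z : R[i]^o) :
  derivable (fun w : R[i]^o => cexpi w *: v) z 1.
Proof.
apply/cvg_ex; exists ((cexpi z * 'i%C) *: v).
have cv : cexpi z * (h^-1 * (cexpi h - 1)) @[h --> (0 : R[i]^o)^'] -->
    (cexpi z * 'i%C : R[i]^o).
  by apply: cvgMr; exact: cexpi_derive0.
have cvv := @cvgZr_tmp R[i] V R[i]^o _ (@dnbhs_filter _ (0 : R[i]^o)) _ _ v cv.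
apply: cvg_trans cvv.
apply: near_eq_cvg; near=> h => /=.
rewrite -scalerBl scalerA; congr (_ *: _).
by rewrite /GRing.scale/= mulr1 cexpiD; ring.
Unshelve. all: by end_near.
Qed.
End ComplexExponential.

(** * KMS states *)

Lemma norm_expi {R : realType} (tau : R) : `|expi tau| = 1.
Proof. by rewrite normc_def /= cos2Dsin2 sqrtr1. Qed.

Section KMSState.
Context {R : realType} {G : digraph} {A : cstarAlgType R[i]} {S : edge G -> A}.
Context {alpha : R[i] -> A -> A} {phi : {scalar A}} {beta : R}.
Hypothesis S_ck : cuntz_krieger_family S.
Hypothesis alpha_gauge : is_gauge_action S alpha.
Hypothesis phi_kms : is_KMS_state alpha beta phi.

(** This is the KMS condition for [a = S e] and [b = star (S e)]: the extension [cexpi z *: S e]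
    takes the value [expR (- beta) *: S e] at [i beta]. *)
Lemma KMS_edge_proj e :
  phi (S e * star (S e)) = (expR (- beta))%:C * phi (star (S e) * S e).
Proof.
have [_ kms] := phi_kms.
rewrite (kms _ (fun z => cexpi z *: S e)); last first.
  split=> [z|tau]; first exact: cexpi_scale_derivable.
  by have [_ ->] := alpha_gauge _ (norm_expi tau); rewrite cexpi_real.
by rewrite cexpi_imag -scalerAr linearZ.
Qed.

Lemma state_edge_proj_ge0 e : 0 <= phi (S e * star (S e)).
Proof. by have [[pos _] _] := phi_kms; have := pos (star (S e)); rewrite starK. Qed.

Lemma KMS_eigenvector e :
  \sum_(f : edge G) (adj e f)%:R * phi (S f * star (S f)) =
    (expR beta)%:C * phi (S e * star (S e)).
Proof.
rewrite KMS_edge_proj mulrA -rmorphM -expRD subrr expR0 mul1r.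
have [_ _ ->] := S_ck; rewrite linear_sum; apply: eq_bigr => f _.
by rewrite raddfMn mulr_natl.
Qed.

Lemma KMS_edge_proj_sum : \sum_(e : edge G) phi (S e * star (S e)) = 1.
Proof.
by have [_ S1 _] := S_ck; have [[_ phi1] _] := phi_kms; rewrite -linear_sum S1.
Qed.

End KMSState.

(** * Uniqueness of nonnegative eigenvectors of the edge matrix *)

Section EdgeMatrix.
Context {R : realType} {G : digraph}.

Definition edge_col (x : edge G -> R) : 'cV[R]_#|edge G| := \col_i x (enum_val i).

Lemma edge_mx_mul_col (x : edge G -> R) (a : R) :
  (forall e, \sum_(f : edge G) (adj e f)%:R * x f = a * x e) ->
  edge_mx G R *m edge_col x = a *: edge_col x.
Proof.
move=> h; apply/colP => i; rewrite !mxE -h.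
rewrite (big_enum_val (A := edge G)) /=.
by apply: eq_bigr => j _; rewrite !mxE.
Qed.

Lemma mx_pow_eigen (n : nat) (B : 'M[R]_n) (x : 'cV[R]_n) a k :
  B *m x = a *: x -> B ^+ k *m x = a ^+ k *: x.
Proof.
move=> h; elim: k => [|k IH]; first by rewrite !expr0 mul1mx scale1r.
by rewrite exprSr -mulmxA h -scalemxAr IH scalerA -exprS.
Qed.

(** Both vectors are eigenvectors of a positive power of the edge matrix, with eigenvalues [a ^+ k]
    and [b ^+ k], which need not be known to agree. *)
Lemma aperiodic_eigenvector_unique (x t : edge G -> R) (a b : R) :
  aperiodic G -> (forall e, 0 <= x e) -> (forall e, 0 < t e) ->
  (forall e, \sum_(f : edge G) (adj e f)%:R * x f = a * x e) ->
  (forall e, \sum_(f : edge G) (adj e f)%:R * t f = b * t e) ->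
  \sum_(e : edge G) x e = 1 -> \sum_(e : edge G) t e = 1 -> x =1 t.
Proof.
move=> [k [_ pos]] x0 t0 /edge_mx_mul_col/(mx_pow_eigen _ _ _ _ k) xa.
move=> /edge_mx_mul_col/(mx_pow_eigen _ _ _ _ k) tb x1 t1 e.
have Bpos i j : 0 < (edge_mx G R ^+ k) i j.
  (* Aperiodicity concerns integer entries; the ring morphism to [R] commutes with matrix powers. *)
  have -> : edge_mx G R = map_mx intr (edge_mx G int).
    by apply/matrixP => i' j'; rewrite !mxE rmorph_nat.
  by rewrite -rmorphXn /= mxE ltr0z pos.
have colsum (y : edge G -> R) : \sum_i edge_col y i 0 = \sum_(f : edge G) y f.
  rewrite (big_enum_val (A := edge G)) /=.
  by apply: eq_bigr => j _; rewrite !mxE.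
have := pos_mx_eigenvector_unique _ Bpos _ _ _ _ _ _ xa tb.
rewrite !colsum => /(_ _ _ x1 t1) xt.
have /colP/(_ (enum_rank e)) : edge_col x = edge_col t.
  by apply: xt => i; rewrite mxE.
by rewrite !mxE enum_rankK.
Qed.
End EdgeMatrix.

(** * Catalan numbers and generating functions *)

Section CatalanState.
Context {R : realType} {G : digraph} {A B : cstarAlgType R[i]}.
Context {S : edge G -> A} {Shat : edge G -> B} {phi : {scalar A}}.

(** Every word counted at [v] evaluates to [P_v]; at [n = 0] the conventions [1] and [phi(P_v)] fit
    the same formula. *)
Lemma catalan_state_atE v n :
  catalan_state_at S Shat phi v n =
    (catalan_nb S Shat v n)%:R * phi (vertex_proj S v).
Proof.
case: n => [|n] /=; first by rewrite mul1r.
rewrite (eq_bigr (fun=> phi (vertex_proj S v))) => [|X].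
  by rewrite sumr_const mulr_natl.
by rewrite inE => /andP[_ /eqP ->].
Qed.

Hypothesis S_ck : cuntz_krieger_family S.
Hypothesis Shat_cuntz : cuntz_family Shat.
Hypothesis E2 : (1 < #|edge G|)%N.
Hypothesis phi_proj : forall v, phi (vertex_proj S v) != 0.
Hypothesis phi1 : phi 1 = 1.

(** Projections at distinct vertices are orthogonal, so equality would make [P_v] vanish, against
    [phi(P_v) != 0]. *)
Lemma vertex_proj_inj v w : vertex_proj S v = vertex_proj S w -> v = w.
Proof.
move=> vw; have := vertex_proj_mul S S_ck v w; case: eqVneq => [//|_].
rewrite -vw vertex_proj_mul// eqxx => v0.
by have := phi_proj v; rewrite v0 linear0 eqxx.
Qed.

Lemma catalan_state_sum n :
  catalan_state S Shat phi n = \sum_v catalan_state_at S Shat phi v n.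
Proof.
case: n => [|n] /=.
  by rewrite -linear_sum sum_vertex_proj.
under [RHS]eq_bigr => v _.
  under eq_bigl => X do rewrite inE.
  rewrite big_mkcondr /=.
  over.
(* For a fixed word, the sum over vertices has exactly one nonzero term, by injectivity of
   [v |-> P_v]. *)
rewrite exchange_big /=; apply: eq_bigr => X XB.
have [v Xv] := catalan_word_vertex_proj S Shat n X E2 S_ck Shat_cuntz XB.
rewrite (bigD1 v)//= -Xv eqxx big1 ?addr0// => w wv.
case: eqP => // Xw; case/eqP: wv.
by apply/esym/vertex_proj_inj; rewrite -Xv.
Qed.
End CatalanState.

(** * Linearity of sums of convergent power series *)

Section GeneratingSeries.
Context {R : realType}.
Local Notation C := R[i].
Local Open Scope classical_set_scope.

Lemma gen_termsZ (c : C) (u : nat -> C) x :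
  gen_terms (fun n => c * u n) x = (fun n => (c : C) *: gen_terms u x n).
Proof.
apply/funext => n; rewrite /gen_terms /series /= scaler_sumr.
by apply: eq_bigr => k _; rewrite -mulrA.
Qed.

Lemma gen_cvgZ (c : C) (u : nat -> C) x : gen_cvg u x ->
  gen_cvg (fun n => c * u n) x /\
  gen_sum (fun n => c * u n) x = c * gen_sum u x.
Proof.
rewrite /gen_cvg /gen_sum gen_termsZ => cu; split; first exact: is_cvgZl_tmp.
exact: limZl_tmp.
Qed.

Lemma gen_termsD (u v : nat -> C) x :
  gen_terms (fun n => u n + v n) x = gen_terms u x \+ gen_terms v x.
Proof.
apply/funext => n; rewrite /gen_terms /series /= -big_split /=.
by apply: eq_bigr => k _; rewrite -mulrDl.
Qed.

Lemma gen_cvg_sum (I : Type) (r : seq I) (u : I -> nat -> C) x :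
  (forall i, gen_cvg (u i) x) ->
  gen_cvg (fun n => \sum_(i <- r) u i n) x /\
  gen_sum (fun n => \sum_(i <- r) u i n) x = \sum_(i <- r) gen_sum (u i) x.
Proof.
move=> cu; elim: r => [|i r [IHc IHs]].
  rewrite big_nil /gen_cvg /gen_sum.
  have -> : gen_terms (fun n => \sum_(i <- [::]) u i n) x = cst 0.
    apply/funext => n; rewrite /gen_terms /series /= big1// => k _.
    by rewrite big_nil mul0r.
  by split; [exact: is_cvg_cst|exact: lim_cst].
have -> : (fun n => \sum_(j <- i :: r) u j n) =
    (fun n => u i n + \sum_(j <- r) u j n).
  by apply/funext => n; rewrite big_cons.
rewrite big_cons -IHs /gen_cvg /gen_sum gen_termsD; split.
  exact: is_cvgD (cu i) IHc.
exact: limD (cu i) IHc.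
Qed.
End GeneratingSeries.

Theorem proposition9p3 (R : realType) (G : digraph)
  (h_in : forall v : vertex G, exists e : edge G, tgt e = v)
  (h_out : forall v : vertex G, exists e : edge G, src e = v)
  (h_card : (2 <= #|edge G|)%N)
  (h_aper : aperiodic G)
  (* the Cuntz-Krieger algebra of [G] and the Cuntz algebra on [edge G] *)
  (OA : cstarAlgType R[i]) (S : edge G -> OA)
  (h_OA : is_cuntz_krieger_algebra S)
  (OE : cstarAlgType R[i]) (Shat : edge G -> OE)
  (h_OE : is_cuntz_algebra Shat)
  (alpha : R[i] -> OA -> OA) (h_alpha : is_gauge_action S alpha)
  (phi : {scalar OA}) (beta : R) (h_phi : is_KMS_state alpha beta phi)
  (r : R) (h_r : is_PF_eigenvalue G r)
  (t : edge G -> R) (t_gt0 : forall e, 0 < t e)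
  (t_eigen : forall e, \sum_(f : edge G) (adj e f)%:R * t f = r * t e)
  (t_sum : \sum_(e : edge G) t e = 1)
  (ed : vertex G -> edge G) (h_ed : forall v, tgt (ed v) = v) :
  let cG v n : R[i] := (catalan_nb S Shat v n)%:R in
  let cphi n : R[i] := catalan_state S Shat phi n in
  let cphi_at v n : R[i] := catalan_state_at S Shat phi v n in
  [/\ forall n v, cphi_at v n = r%:C * cG v n * (t (ed v))%:C,
      forall n, cphi n = r%:C * \sum_(v : vertex G) cG v n * (t (ed v))%:C,
      (* the generating functions as formal power series *)
      (forall v, gen_series (cphi_at v)
                 = (r * t (ed v))%:C *: gen_series (cG v)) /\
      gen_series cphi
        = r%:C *: \sum_(v : vertex G) (t (ed v))%:C *: gen_series (cG v)
    & (* the generating functions as functions of a complex variable *)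
      (forall v x, gen_cvg (cG v) x ->
         gen_cvg (cphi_at v) x /\
         gen_sum (cphi_at v) x
         = r%:C * gen_sum (cG v) x * (t (ed v))%:C) /\
      (forall x, (forall v, gen_cvg (cG v) x) ->
         gen_cvg cphi x /\
         gen_sum cphi x
         = r%:C * \sum_(v : vertex G) gen_sum (cG v) x * (t (ed v))%:C)].
Proof.
move=> cG cphi cphi_at.
have [S_ck _ _] := h_OA; have [Shat_c _ _] := h_OE.
have [[_ phi1] _] := h_phi.
have p_real e : (complex.Re (phi (S e * star (S e))))%:C = phi (S e * star (S e)).
  by rewrite RRe_real// ger0_real// (state_edge_proj_ge0 h_phi).
have pt e : phi (S e * star (S e)) = (t e)%:C.
  rewrite -p_real; congr (_%:C); move: e.
  apply: (aperiodic_eigenvector_unique _ t (expR beta) r) => // [e|e|].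
  - by rewrite -lecR p_real (state_edge_proj_ge0 h_phi).
  - apply: complexI; rewrite rmorphM/= p_real -(KMS_eigenvector S_ck h_alpha h_phi).
    rewrite rmorph_sum; apply: eq_bigr => f _.
    by rewrite rmorphM rmorph_nat/= p_real.
  - apply: complexI; rewrite rmorph_sum rmorph1 -(KMS_edge_proj_sum S_ck h_phi).
    by apply: eq_bigr => e _; exact: p_real.
(* The edges starting at [v] are those following [ed v], so the sum of their [t f] is the row of the
   eigenvalue equation at [ed v]. *)
have phiP v : phi (vertex_proj S v) = r%:C * (t (ed v))%:C.
  rewrite -rmorphM -t_eigen rmorph_sum linear_sum big_mkcond.
  apply: eq_bigr => f _; rewrite rmorphM rmorph_nat /= -pt /adj h_ed eq_sym.
  by case: eqP; rewrite ?mul1r ?mul0r.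
(* If [r] were [0], all [phi(P_v)] would vanish although they sum to [phi 1 = 1]. *)
have r_neq0 : r != 0.
  apply/eqP => r0; have := oner_neq0 R[i]; rewrite -phi1 -(sum_vertex_proj S S_ck).
  by rewrite linear_sum big1 ?eqxx// => v _; rewrite phiP r0 mul0r.
have phiP_neq0 v : phi (vertex_proj S v) != 0.
  by rewrite phiP -rmorphM fmorph_eq0 mulf_neq0// gt_eqF.
have atE v n : cphi_at v n = (r * t (ed v))%:C * cG v n.
  by rewrite /cphi_at catalan_state_atE phiP rmorphM mulrC.
have allE n : cphi n = r%:C * \sum_v (t (ed v))%:C * cG v n.
  rewrite /cphi (catalan_state_sum S_ck Shat_c h_card phiP_neq0 phi1) mulr_sumr.
  by apply: eq_bigr => v _; rewrite [LHS]atE rmorphM mulrA.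
split.
- by move=> n v; rewrite atE rmorphM mulrAC.
- by move=> n; rewrite allE; congr (_ * _); apply: eq_bigr => v _; rewrite mulrC.
- split=> [v|]; apply/funext => n; first exact: atE.
  rewrite /gen_series [LHS]allE.
  rewrite [RHS]/GRing.scale /=; congr (_ * _).
  (* A sum of formal series is evaluated coefficientwise. *)
  by elim/big_ind2 : _ => // ? ? ? ? -> ->.
split=> [v x cx|x cx].
  have -> : cphi_at v = fun n => (r * t (ed v))%:C * cG v n by apply/funext.
  have [? ->] := gen_cvgZ (r * t (ed v))%:C _ _ cx; split=> //.
  by rewrite rmorphM mulrAC.
have -> : cphi = fun n => r%:C * \sum_v (t (ed v))%:C * cG v n by apply/funext.
have [] := gen_cvg_sum _ (index_enum (vertex G))
  (fun v n => (t (ed v))%:C * cG v n) x (fun v => (gen_cvgZ _ _ _ (cx v)).1).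
move=> /(gen_cvgZ r%:C)[? ->] ->; split=> //; congr (_ * _).
by apply: eq_bigr => v _; rewrite (gen_cvgZ _ _ _ (cx v)).2 mulrC.
Qed.
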